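(* Let $F$ be a field with $\operatorname{char} F\ne 2$. Every Rota--Baxter operator of nonzero weight on the simple Jordan (Kaplansky) superalgebra $\mathrm{K}_3$ over $F$ is splitting.
   Context: $\mathrm{K}_3=A_0\oplus A_1$ is the three-dimensional algebra with even part $A_0=\mathrm{span}\{e\}$, odd part $A_1=\mathrm{span}\{x,y\}$ and product $e^2=e$, $ex=xe=\frac{x}{2}$, $ey=ye=\frac{y}{2}$, $xy=-yx=\frac{e}{2}$, $x^2=y^2=0$. A linear operator $R\colon A\to A$ (not assumed to preserve any grading) on an algebra $A$ over $F$ is a Rota--Baxter operator of weight $\Delta\in F$ if $R(u)R(v)=R(R(u)v+uR(v)+\Delta uv)$ for all $u,v\in A$. A Rota--Baxter operator $R$ of weight $\Delta$ on $A$ is called splitting if there are subalgebras $B_1,B_2$ of $A$ (possibly zero, not necessarily graded) such that $A=B_1\oplus B_2$ as vector spaces and $R(b_1+b_2)=-\Delta b_2$ for all $b_1\in B_1$, $b_2\in B_2$. *)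

(* Defs.v *)
From HB Require Import structures.
From mathcomp Require Import all_boot all_order all_algebra.

Set Implicit Arguments.
Unset Strict Implicit.
Unset Printing Implicit Defensive.

Import GRing.Theory.
Local Open Scope ring_scope.

(* An algebra over F, not assumed associative, commutative or unital, is a
   finite-dimensional vector space A with a bilinear product mul. *)
Section RotaBaxter.
Variables (F : fieldType) (A : vectType F) (mul : {bilinear A -> A -> A}).

Definition is_subalgebra (B : {vspace A}) : Prop :=
  forall u v : A, u \in B -> v \in B -> mul u v \in B.

Definition rota_baxter (Delta : F) (R : 'End(A)) : Prop :=
  forall u v : A,
    mul (R u) (R v) = R (mul (R u) v + mul u (R v) + Delta *: mul u v).

Definition splitting (Delta : F) (R : 'End(A)) : Prop :=
  exists B1 B2 : {vspace A},
    [/\ is_subalgebra B1, is_subalgebra B2,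
        (B1 + B2)%VS = fullv, directv (B1 + B2) &
        forall b1 b2 : A, b1 \in B1 -> b2 \in B2 ->
          R (b1 + b2) = - (Delta *: b2)].

End RotaBaxter.

Notation K3 F := 'rV[F]_3.

Section Kaplansky.
Variable F : fieldType.

(* Even part: the span of K3e; odd part: the span of K3x and K3y. *)
Definition K3e : K3 F := delta_mx 0 (@inord 2 0).
Definition K3x : K3 F := delta_mx 0 (@inord 2 1).
Definition K3y : K3 F := delta_mx 0 (@inord 2 2).

(* Products of basis vectors, in the order e, x, y. *)
Definition K3_table (i j : 'I_3) : K3 F :=
  match val i, val j with
  | 0%N, 0%N => K3e
  | 0%N, 1%N | 1%N, 0%N => 2^-1 *: K3x
  | 0%N, 2%N | 2%N, 0%N => 2^-1 *: K3y
  | 1%N, 2%N => 2^-1 *: K3e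
  | 2%N, 1%N => - (2^-1 *: K3e)
  | _, _ => 0
  end.

Definition K3_mul (u v : K3 F) : K3 F :=
  \sum_(i < 3) \sum_(j < 3) (u 0 i * v 0 j) *: K3_table i j.

Lemma K3_mul_linearl (v : K3 F) : linear (K3_mul^~ v).
Proof.
move=> a w1 w2; rewrite /K3_mul scaler_sumr -big_split; apply: eq_bigr => i _.
rewrite scaler_sumr -big_split; apply: eq_bigr => j _.
by rewrite !mxE /= scalerA -scalerDl mulrDl mulrA.
Qed.

Lemma K3_mul_linearr (u : K3 F) : linear (K3_mul u).
Proof.
move=> a w1 w2; rewrite /K3_mul scaler_sumr -big_split; apply: eq_bigr => i _.
rewrite scaler_sumr -big_split; apply: eq_bigr => j _.
by rewrite !mxE /= scalerA -scalerDl mulrDr mulrCA.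
Qed.

HB.instance Definition _ :=
  bilinear_isBilinear.Build F (K3 F) (K3 F) (K3 F) *:%R *:%R K3_mul
    (K3_mul_linearl, K3_mul_linearr).

Lemma K3_mul_delta (i j : 'I_3) :
  K3_mul (delta_mx 0 i) (delta_mx 0 j) = K3_table i j.
Proof.
rewrite /K3_mul (bigD1 i) //= [X in _ + X]big1 => [|k nki].
  rewrite addr0 (bigD1 j) //= [X in _ + X]big1 => [|k nkj].
    by rewrite addr0 !mxE !eqxx mulr1 scale1r.
  by rewrite !mxE (negbTE nkj) andbF mulr0 scale0r.
by rewrite big1 // => l _; rewrite !mxE (negbTE nki) andbF mul0r scale0r.
Qed.

Lemma K3_mulE :
  [/\ K3_mul K3e K3e = K3e,
      K3_mul K3e K3x = 2^-1 *: K3x /\ K3_mul K3x K3e = 2^-1 *: K3x,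
      K3_mul K3e K3y = 2^-1 *: K3y /\ K3_mul K3y K3e = 2^-1 *: K3y,
      K3_mul K3x K3y = 2^-1 *: K3e /\ K3_mul K3y K3x = - (2^-1 *: K3e) &
      K3_mul K3x K3x = 0 /\ K3_mul K3y K3y = 0].
Proof. by rewrite /K3e /K3x /K3y !K3_mul_delta /K3_table /= !inordK. Qed.

End Kaplansky.

(* Main.v *)
Require Import Defs.
From HB Require Import structures.
From mathcomp Require Import all_boot all_order all_algebra.
From mathcomp Require Import ring.

Set Implicit Arguments.
Unset Strict Implicit.
Unset Printing Implicit Defensive.

Import GRing.Theory.
Local Open Scope ring_scope.

(** Let [eps u] be the coordinate of [u] along [e]. Although K3 is not
    commutative, its symmetrized product depends only on [eps]:
    [u v + v u = eps u *: v + eps v *: u]. Put [N := R^2 + Delta R].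
    Adding the Rota-Baxter identities for [(u, v)] and [(v, u)], everything
    cancels except [eps v *: N u + eps u *: N v = 0]. Taking [u = v = e] gives
    [N e = 0], and then [v = e] gives [N = 0]. Hence [R = - Delta] on its image,
    and A is the direct sum of the subalgebras [ker R] and [im R]. *)

(** For [u], [v] in the kernel the identity collapses to [Delta *: R (mul u v) = 0]. *)
Lemma rota_baxter_ker_subalgebra (F : fieldType) (A : vectType F)
    (mul : {bilinear A -> A -> A}) (Delta : F) (R : 'End(A)) :
  Delta != 0 -> rota_baxter mul Delta R -> is_subalgebra mul (lker R).
Proof.
move=> Dn0 RB u v; rewrite !memv_ker => /eqP Ru0 /eqP Rv0.
have := RB u v; rewrite Ru0 Rv0 !(linear0l, linear0r) !add0r linearZ /=.
by move/esym/eqP; rewrite scaler_eq0 (negbTE Dn0).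
Qed.

Lemma rota_baxter_img_subalgebra (F : fieldType) (A : vectType F)
    (mul : {bilinear A -> A -> A}) (Delta : F) (R : 'End(A)) :
  rota_baxter mul Delta R -> is_subalgebra mul (limg R).
Proof.
by move=> RB _ _ /memv_imgP[u _ ->] /memv_imgP[v _ ->]; rewrite RB memv_img ?memvf.
Qed.

Lemma rota_baxter_quadratic_splitting (F : fieldType) (A : vectType F)
    (mul : {bilinear A -> A -> A}) (Delta : F) (R : 'End(A)) :
  Delta != 0 -> rota_baxter mul Delta R ->
  (forall u, R (R u) = - (Delta *: R u)) -> splitting mul Delta R.
Proof.
move=> Dn0 RB R2; exists (lker R), (limg R).
have R_img b : b \in limg R -> R b = - (Delta *: b).
  by case/memv_imgP => u _ ->; apply: R2.
split.
- exact: rota_baxter_ker_subalgebra Dn0 RB.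
- exact: rota_baxter_img_subalgebra RB.
- apply/eqP; rewrite eqEsubv subvf /=; apply/subvP => u _.
  (* Split [u] as [(u + Delta^-1 *: R u) - Delta^-1 *: R u]; [R] kills the first summand by [R2]. *)
  rewrite -[u](subrK (- (Delta^-1 *: R u))); apply: memv_add; last first.
    by rewrite memvN memvZ // memv_img ?memvf.
  rewrite memv_ker opprK linearD linearZ /= R2.
  by rewrite scalerN scalerA mulVf // scale1r subrr.
(* On the intersection [R b] is both [0] and [- (Delta *: b)]. *)
- apply/directv_addP/eqP; rewrite -subv0; apply/subvP => b.
  rewrite memv_cap memv_ker memv0 => /andP[/eqP Rb0 /R_img /esym /eqP].
  by rewrite Rb0 oppr_eq0 scaler_eq0 (negbTE Dn0).
- move=> b1 b2; rewrite memv_ker => /eqP Rb1 /R_img Rb2.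
  by rewrite linearD /= Rb1 add0r.
Qed.

(** Products of odd elements are antisymmetric and cancel, while [e] acts on the odd part as one
    half from either side, so the two halves add up to the identity. *)
Lemma K3_mul_sym (F : fieldType) (u v : K3 F) : 2 != 0 :> F ->
  K3_mul u v + K3_mul v u = u 0 0 *: v + v 0 0 *: u.
Proof.
move=> n2; apply/rowP => j.
rewrite /K3_mul !big_ord_recl !big_ord0 /K3_table /= !mxE.
have -> : lift ord0 ord0 = inord 1 :> 'I_3 by apply/val_inj; rewrite /= inordK.
have -> : lift ord0 (lift ord0 ord0) = inord 2 :> 'I_3.
  by apply/val_inj; rewrite /= inordK.
case: j => -[|[|[|//]]] lt_j3.
- have -> : Ordinal lt_j3 = 0 by apply: val_inj.
  rewrite -!val_eqE /= !inordK //=; by field.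
- have -> : Ordinal lt_j3 = inord 1 by apply: val_inj; rewrite /= inordK.
  rewrite -!val_eqE /= !inordK //=; by field.
- have -> : Ordinal lt_j3 = inord 2 by apply: val_inj; rewrite /= inordK.
  rewrite -!val_eqE /= !inordK //=; by field.
Qed.

Lemma K3_rota_baxter_sym (F : fieldType) (Delta : F) (R : 'End(K3 F))
    (N := fun u => R (R u) + Delta *: R u) (u v : K3 F) :
  2 != 0 :> F -> rota_baxter (@K3_mul F) Delta R ->
  v 0 0 *: N u + u 0 0 *: N v = 0.
Proof.
move=> n2 RB; have := K3_mul_sym (R u) (R v) n2.
rewrite (RB u v) (RB v u) -linearD /=.
(* Regroup into three symmetrized products, so that [K3_mul_sym] eliminates the multiplication. *)
have -> : K3_mul (R u) v + K3_mul u (R v) + Delta *: K3_mul u v +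
    (K3_mul (R v) u + K3_mul v (R u) + Delta *: K3_mul v u) =
  (K3_mul (R u) v + K3_mul v (R u)) + (K3_mul (R v) u + K3_mul u (R v)) +
  Delta *: (K3_mul u v + K3_mul v u).
  by apply/rowP => j; rewrite !mxE; ring.
(* The terms [(R u) 0 0 *: R v] and [(R v) 0 0 *: R u] occur on both sides and cancel. *)
rewrite !K3_mul_sym // !(linearD, linearZ) /= => /rowP E.
apply/rowP => j; have /eqP := E j; rewrite -subr_eq0 => /eqP E0.
by rewrite !mxE in E0 *; rewrite -[RHS]E0; ring.
Qed.

Theorem theorem5 (F : fieldType) (charF : 2%N \notin [pchar F])
    (Delta : F) (Delta_neq0 : Delta != 0) (R : 'End(K3 F))
    (RB_R : rota_baxter (@K3_mul F) Delta R) :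
  splitting (@K3_mul F) Delta R.
Proof.
have n2 : 2 != 0 :> F by move: charF; rewrite inE.
have e0 : K3e F 0 0 = 1 by rewrite mxE -!val_eqE /= inordK.
apply: rota_baxter_quadratic_splitting => // u; apply/eqP; rewrite -addr_eq0.
have := K3_rota_baxter_sym (K3e F) (K3e F) n2 RB_R.
rewrite e0 scale1r -mulr2n -scaler_nat => /eqP.
rewrite scaler_eq0 (negbTE n2) /= => /eqP Ne0.
have := K3_rota_baxter_sym u (K3e F) n2 RB_R.
by rewrite Ne0 e0 scale1r scaler0 addr0 => ->.
Qed.
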